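(* Suppose that the kernel $\mathfrak{K}$ defining the RKHS $H(\Omega)$ is bounded on the diagonal, i.e. there is a constant $\bar{\mathfrak{K}}$ with $\mathfrak{K}(x,x)\le \bar{\mathfrak{K}}^2$ for all $x\in\Omega$. Suppose in addition that the family of subspaces $\{H_N\}_{N\in\mathbb{N}}$ and the trajectory $t\mapsto x(t)$ are persistently exciting in the following sense: there are positive constants $\Delta(N),\gamma_1(N)$ depending on $N$, and a constant $\gamma_2>0$ (independent of $N$), such that for each $N\in\mathbb{N}$ and all $t\ge 0$ $$\gamma_1(N)\, I_{H_N}\ \le\ S_N(t):=\int_t^{t+\Delta(N)} \Pi_N A^*E_{x(\tau)}^*E_{x(\tau)}A\Pi_N\,\mathrm{d}\tau\ \le\ \gamma_2\, I_{H_N},$$ where $S_N(t):H_N\to H_N$ and $I_{H_N}$ is the identity of $H_N$. Let $\hat v_N(t,\cdot)\in H_N$ be the solution of the gradient learning law $$\frac{\mathrm{d}}{\mathrm{d}t}\hat v_N(t,\cdot)=-a\,\Pi_NA^*E_{x(t)}^*E_{x(t)}A\Pi_N\hat v_N(t,\cdot)+a\,\Pi_NA^*E_{x(t)}^*\,y(t),\qquad y(t)=E_{x(t)}Av,$$ with $a>0$, and set $\bar v_N(t,\cdot):=\Pi_N v-\hat v_N(t,\cdot)$. Then there is a constant $\delta>0$ (of order one, not depending on $N$ or $t$) such that, for every $N\in\mathbb N$ and $t\ge 0$, $$\|\bar v_N(t,\cdot)\|_{H(\Omega)}\ \le\ \frac{\sqrt{\gamma_2\Delta(N)}}{\gamma_1(N)}\Big(\bar{\mathcal{Y}}_{N,\max}+\delta\gamma_2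 a\big(\bar{\mathcal{Y}}_{N,\max}+\epsilon_{N,\max}\big)\Big),$$ where $$\bar{\mathcal{Y}}_{N,\max}:=\sup_{\tau\in[t,t+\Delta(N)]}\big|E_{x(\tau)}A\Pi_N\bar v_N(\tau,\cdot)\big|,\qquad \epsilon_{N,\max}:=\sup_{\tau\in[t,t+\Delta(N)]}\epsilon_N(\tau),\qquad \epsilon_N(\tau):=\big|E_{x(\tau)}A(I-\Pi_N)v\big|.$$
   Context: Setting. $\Omega\subset\mathbb{R}^n$ is a compact set. $f:\mathbb{R}^n\to\mathbb{R}^n$ and $g:\mathbb{R}^n\to\mathbb{R}^{n\times m}$ define the system $\dot x(t)=f(x(t))+g(x(t))\mu(x(t))$, $x(0)=x_0$, under a continuous stabilizing feedback $\mu:\mathbb{R}^n\to\mathbb{R}^m$; $t\mapsto x(t)$ is its trajectory, assumed to remain in $\Omega$ for $t\ge 0$. The running cost is $r(x)=Q(x)+\mu(x)^{\mathrm T}R\mu(x)$ with $Q\ge 0$, $R\succ 0$, and $v=V_\mu$ is the value function of $\mu$, i.e. $(f+g\mu)^{\mathrm T}\nabla v+r=0$ on $\Omega$, $v(0)=0$; it is assumed that $v\in H(\Omega)$. RKHS. $\mathfrak{K}:\Omega\times\Omega\to\mathbb{R}$ is a Mercer kernel (continuous, symmetric, of positive type: all matrices $[\mathfrak{K}(\xi_i,\xi_j)]$ are positive semidefinite), of class $C^{2m'}(\Omega,\Omega)$ for some integer $m'\ge1$. $\mathfrak{K}_x:=\mathfrak{K}(x,\cdot)$. $H(\Omega)$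 is the closure of $\mathrm{span}\{\mathfrak{K}_x: x\in\Omega\}$ with respect to the inner product determined by $(\mathfrak{K}_x,\mathfrak{K}_y)=\mathfrak{K}(x,y)$. $E_x:H(\Omega)\to\mathbb{R}$, $E_xh=h(x)$, is the evaluation functional (the same notation is used for evaluating continuous functions at $x$). For each $N$, $\Xi_N=\{\xi_1,\dots,\xi_N\}\subset\Omega$ is a set of $N$ centers, $H_N:=\mathrm{span}\{\mathfrak{K}_{\xi_i}:1\le i\le N\}$, and $\Pi_N:H(\Omega)\to H_N$ is the $H(\Omega)$-orthogonal projection. Differential operator. $(Ah)(x):=(f(x)+g(x)\mu(x))^{\mathrm T}\nabla h(x)$. The components of $f,g,\mu$ are assumed to be multipliers for $C(\Omega)$ and $H(\Omega)$, and $A:H(\Omega)\to C(\Omega)$ is a bounded linear operator. $A^*E_x^*:\mathbb{R}\to H(\Omega)$ denotes the adjoint of the bounded functional $E_xA:H(\Omega)\to\mathbb{R}$. The paper's standing regularity condition is that the value function errors $\tilde v=v-\hat v$ considered satisfy $A\tilde v\in H(\Omega)$. Operator inequalities on $H_N$ are in the sense of quadratic forms for the $H(\Omega)$ inner product. *)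

(* Defs.v *)
From HB Require Import structures.
From mathcomp Require Import all_boot all_order all_algebra.
From mathcomp Require Import all_classical all_reals all_analysis.

Set Implicit Arguments.
Unset Strict Implicit.
Unset Printing Implicit Defensive.

Import Order.TTheory GRing.Theory Num.Theory.
Import numFieldNormedType.Exports.

Local Open Scope classical_set_scope.
Local Open Scope ring_scope.

Definition dotp (R : realType) (n : nat) (u w : 'cV[R]_n) : R :=
  (u^T *m w) ord0 ord0.

(* [w] is a gradient at [x] of [h] regarded as a function on [D]: only
   increments that stay in [D] are tested, so that this makes sense at the
   boundary points of a compact set. At interior points of [D] it is the usual
   gradient. *)
Definition is_gradient_within (R : realType) (n : nat) (D : set 'cV[R]_n)
    (h : 'cV[R]_n -> R) (x w : 'cV[R]_n) : Prop :=
  forall e : R, 0 < e ->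
    \forall y \near within D (nbhs x),
      `|h y - h x - dotp w (y - x)| <= e * `|y - x|.

Fixpoint Ck_on (R : realType) (n k : nat) (D : set 'cV[R]_n)
    (h : 'cV[R]_n -> R) {struct k} : Prop :=
  {within D, continuous h} /\
  if k is k'.+1 then
    exists G : 'cV[R]_n -> 'cV[R]_n,
      (forall x, D x -> is_gradient_within D h x (G x)) /\
      (forall i : 'I_n, Ck_on k' D (fun x => G x i ord0))
  else True.

(* A function on [R^n * R^n] is viewed as a function on [R^(n + n)]. *)
Definition Ck_kernel (R : realType) (n k : nat) (Omega : set 'cV[R]_n)
    (K : 'cV[R]_n -> 'cV[R]_n -> R) : Prop :=
  Ck_on k [set z : 'cV[R]_(n + n) | Omega (usubmx z) /\ Omega (dsubmx z)]
    (fun z => K (usubmx z) (dsubmx z)).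

Record mercer_kernel (R : realType) (n : nat) (Omega : set 'cV[R]_n)
    (K : 'cV[R]_n -> 'cV[R]_n -> R) : Prop := MercerKernel {
  mercer_cont :
    {within Omega `*` Omega, continuous (fun z => K z.1 z.2)} ;
  mercer_sym : forall x y, Omega x -> Omega y -> K x y = K y x ;
  mercer_psd : forall (p : nat) (xi : 'I_p -> 'cV[R]_n) (c : 'I_p -> R),
    (forall i, Omega (xi i)) ->
    0 <= \sum_(i < p) \sum_(j < p) c i * c j * K (xi i) (xi j) }.

Record inner_product (R : realType) (H : normedModType R) (ip : H -> H -> R)
    : Prop := InnerProduct {
  ip_sym : forall h k, ip h k = ip k h ;
  ip_linear : forall (c : R) h1 h2 k, ip (c *: h1 + h2) k = c * ip h1 k + ip h2 k ;
  ip_norm : forall h, ip h h = `|h| ^+ 2 }.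

Definition linspan (R : realType) (H : lmodType R) (X : set H) : set H :=
  [set h | exists (p : nat) (c : 'I_p -> R) (u : 'I_p -> H),
     (forall i, X (u i)) /\ h = \sum_(i < p) c i *: u i].

(* The Hilbert space [H] is the native space of the kernel [K] on [Omega]:
   [kx x] is the kernel section [K(x, .)], and [ev h] is the function
   represented by the element [h]. Values of [ev h] outside [Omega] are
   irrelevant, and elements of [H] are determined by their values on [Omega]
   (by [rkhs_repr] and [rkhs_dense]). *)
Record is_rkhs (R : realType) (n : nat) (Omega : set 'cV[R]_n)
    (K : 'cV[R]_n -> 'cV[R]_n -> R) (H : completeNormedModType R)
    (ip : H -> H -> R) (kx : 'cV[R]_n -> H) (ev : H -> 'cV[R]_n -> R)
    : Prop := IsRKHS {
  rkhs_ip : inner_product ip ;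
  rkhs_kx : forall x y, Omega x -> Omega y -> ev (kx x) y = K x y ;
  rkhs_ip_kx : forall x y, Omega x -> Omega y -> ip (kx x) (kx y) = K x y ;
  rkhs_repr : forall h x, Omega x -> ev h x = ip (kx x) h ;
  rkhs_dense : closure (linspan (kx @` Omega)) = setT }.

Definition is_orth_proj (R : realType) (H : normedModType R)
    (ip : H -> H -> R) (V : set H) (P : H -> H) : Prop :=
  forall h, V (P h) /\ forall k, V k -> ip (h - P h) k = 0.

(* [Ls : R -> H] is the adjoint of the functional [L : H -> R], the inner
   product of [R] being the product. *)
Definition is_adjoint (R : realType) (H : normedModType R) (ip : H -> H -> R)
    (L : H -> R) (Ls : R -> H) : Prop :=
  forall (c : R) (h : H), ip (Ls c) h = c * L h.

(* [I] is the (weak) integral of the curve [c] over [[s, t]]; on a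
   finite-dimensional space this is the usual vector-valued integral. *)
Definition is_integral (R : realType) (H : normedModType R) (ip : H -> H -> R)
    (s t : R) (c : R -> H) (I : H) : Prop :=
  forall k : H,
    (@lebesgue_measure R).-integrable `[s, t] (EFin \o (fun tau => ip (c tau) k))
    /\ ip I k = \int[@lebesgue_measure R]_(tau in `[s, t]) ip (c tau) k.

(* Two-sided derivatives are used at positive times; the initial time is
   covered by continuity. *)
Definition is_ode_solution (R : realType) (V : normedModType R)
    (phi : R -> V -> V) (z : R -> V) : Prop :=
  {within `[0, +oo[, continuous z} /\
  forall t : R, 0 < t -> is_derive t 1 z (phi t (z t)).

Definition closed_loop (R : realType) (n m : nat)
    (f : 'cV[R]_n -> 'cV[R]_n) (g : 'cV[R]_n -> 'M[R]_(n, m))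
    (mu : 'cV[R]_n -> 'cV[R]_m) (x : 'cV[R]_n) : 'cV[R]_n :=
  f x + g x *m mu x.

(* Stability of the origin in the sense of Lyapunov. Attractivity is not part
   of it: a trajectory converging to an equilibrium can never be persistently
   exciting. *)
Definition stabilizing (R : realType) (n m : nat) (Omega : set 'cV[R]_n)
    (f : 'cV[R]_n -> 'cV[R]_n) (g : 'cV[R]_n -> 'M[R]_(n, m))
    (mu : 'cV[R]_n -> 'cV[R]_m) : Prop :=
  closed_loop f g mu 0 = 0 /\
  forall e : R, 0 < e -> exists2 d : R, 0 < d &
    forall z : R -> 'cV[R]_n,
      is_ode_solution (fun=> closed_loop f g mu) z ->
      (forall t, 0 <= t -> Omega (z t)) ->
      `|z 0| < d -> forall t, 0 <= t -> `|z t| < e.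

Definition posdefmx (R : realType) (m : nat) (W : 'M[R]_m) : Prop :=
  W^T = W /\ forall u : 'cV[R]_m, u != 0 -> 0 < dotp u (W *m u).

Definition running_cost (R : realType) (n m : nat) (Q : 'cV[R]_n -> R)
    (W : 'M[R]_m) (mu : 'cV[R]_n -> 'cV[R]_m) (x : 'cV[R]_n) : R :=
  Q x + dotp (mu x) (W *m mu x).

Definition multiplier_C (R : realType) (n : nat) (Omega : set 'cV[R]_n)
    (phi : 'cV[R]_n -> R) : Prop :=
  forall h : 'cV[R]_n -> R, {within Omega, continuous h} ->
    {within Omega, continuous (fun x => phi x * h x)}.

Definition multiplier_H (R : realType) (n : nat) (Omega : set 'cV[R]_n)
    (H : normedModType R) (ev : H -> 'cV[R]_n -> R)
    (phi : 'cV[R]_n -> R) : Prop :=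
  forall h : H, exists h' : H, forall x, Omega x -> ev h' x = phi x * ev h x.

Definition multiplier (R : realType) (n : nat) (Omega : set 'cV[R]_n)
    (H : normedModType R) (ev : H -> 'cV[R]_n -> R)
    (phi : 'cV[R]_n -> R) : Prop :=
  multiplier_C Omega phi /\ multiplier_H Omega ev phi.

Record bounded_linear_C (R : realType) (n : nat) (Omega : set 'cV[R]_n)
    (H : normedModType R) (A : H -> 'cV[R]_n -> R) : Prop := BoundedLinearC {
  blC_cont : forall h, {within Omega, continuous (A h)} ;
  blC_linear : forall (c : R) h1 h2 x, Omega x ->
    A (c *: h1 + h2) x = c * A h1 x + A h2 x ;
  blC_bounded : exists M : R, forall h x, Omega x -> `|A h x| <= M * `|h| }.

(* Where [Omega] is too thin to determine the gradient, [A h x] is computed from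
   some gradient; in the directions tangent to [Omega], hence along
   trajectories, the value does not depend on the choice. *)
Definition is_directional_operator (R : realType) (n : nat)
    (Omega : set 'cV[R]_n) (H : normedModType R) (ev : H -> 'cV[R]_n -> R)
    (F : 'cV[R]_n -> 'cV[R]_n) (A : H -> 'cV[R]_n -> R) : Prop :=
  forall h x, Omega x ->
    exists2 w, is_gradient_within Omega (ev h) x w & A h x = dotp (F x) w.

Definition center_space (R : realType) (n : nat) (H : lmodType R)
    (kx : 'cV[R]_n -> H) (xi : nat -> 'cV[R]_n) (N : nat) : set H :=
  linspan [set kx (xi i) | i in [set i | (i < N)%N]].

Definition regressor (R : realType) (n : nat) (H : lmodType R)
    (A : H -> 'cV[R]_n -> R) (Aadj : 'cV[R]_n -> R -> H) (P : H -> H)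
    (x : 'cV[R]_n) (h : H) : H :=
  P (Aadj x (A (P h) x)).

Definition sup_on (R : realType) (s t : R) (u : R -> R) : R :=
  sup [set u tau | tau in `[s, t]].

(* Main.v *)
Require Import Defs.
From HB Require Import structures.
From mathcomp Require Import all_boot all_order all_algebra.
From mathcomp Require Import all_classical all_reals all_analysis.
From mathcomp Require Import ring.

(** Fix [N] and write [w = P N v - vhat N], [y = A w] and [e = A (v - P N v)]
    along the trajectory. On [center_space kx xi N] the quadratic form of the
    regressor at [z] is [h |-> (A h z) ^+ 2], so persistency of excitation says
    that the integral [I] of [(A h (x tau)) ^+ 2] over a window lies between
    [gamma1 N * `|h| ^+ 2] and [gamma2 * `|h| ^+ 2].

    Take [h = w t]. If [`|A h (x tau)| <= B] on the window, then also
    [I <= B ^+ 2 * Delta N]; multiplying the two upper bounds of [I] and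
    comparing with the square of the lower one gives
    [gamma1 N * `|h| <= Num.sqrt (gamma2 * Delta N) * B]
    ([persistent_excitation_bound]). To find [B], split
    [A h = A (w tau) + A (w t - w tau)]. The first term is at most
    [Ymax N t]. For the second, let [M] bound the operator [A]. The learning law
    moves [w] with speed at most [a * M * `|y + e|] ([gradient_law_speed]), so
    [`|w t - w tau| <= a * M * (Ymax N t + epsmax N t) * Delta N]
    ([gradient_law_drift]), and a second factor [M] bounds the term.

    This gives the claim with [delta * gamma2 = M ^+ 2 * Delta N], and what
    remains is that [Delta N] is bounded in [N]
    ([excitation_horizons_bounded]). The two excitation bounds together force
    it: a nonzero [h] in some [center_space kx xi N0] also lies in the larger
    spaces, collects at least [gamma1 N0 * `|h| ^+ 2] on each of the disjoint
    windows of length [Delta N0] inside a window of length [Delta N], and cannot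
    collect more than [gamma2 * `|h| ^+ 2] in total. Where the space of centers
    is zero, [w] vanishes and there is nothing to prove. *)

Set Implicit Arguments.
Unset Strict Implicit.
Unset Printing Implicit Defensive.

Import Order.TTheory GRing.Theory Num.Theory.
Import numFieldNormedType.Exports.
Local Open Scope classical_set_scope.
Local Open Scope ring_scope.

(** * Inner products *)

Lemma ipDl (R : realType) (H : normedModType R) (ip : H -> H -> R)
  (hip : inner_product ip) (h1 h2 k : H) :
  ip (h1 + h2) k = ip h1 k + ip h2 k.
Proof. by rewrite -[h1]scale1r (ip_linear hip) mul1r scale1r. Qed.

Lemma ip0l (R : realType) (H : normedModType R) (ip : H -> H -> R)
  (hip : inner_product ip) (k : H) : ip 0 k = 0.
Proof. by apply: (addrI (ip 0 k)); rewrite -(ipDl hip) !addr0. Qed.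

Lemma ipZl (R : realType) (H : normedModType R) (ip : H -> H -> R)
  (hip : inner_product ip) (c : R) (h k : H) : ip (c *: h) k = c * ip h k.
Proof. by rewrite -[c *: h]addr0 (ip_linear hip) (ip0l hip) addr0. Qed.

Lemma ipNl (R : realType) (H : normedModType R) (ip : H -> H -> R)
  (hip : inner_product ip) (h k : H) : ip (- h) k = - ip h k.
Proof. by rewrite -scaleN1r (ipZl hip) mulN1r. Qed.

Lemma ipBl (R : realType) (H : normedModType R) (ip : H -> H -> R)
  (hip : inner_product ip) (h1 h2 k : H) :
  ip (h1 - h2) k = ip h1 k - ip h2 k.
Proof. by rewrite (ipDl hip) (ipNl hip). Qed.

Lemma inner_product_eq0 (R : realType) (H : normedModType R) (ip : H -> H -> R)
  (hip : inner_product ip) (h : H) : ip h h = 0 -> h = 0.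
Proof. by rewrite (ip_norm hip) => /eqP; rewrite sqrf_eq0 normr_eq0 => /eqP. Qed.

Lemma Cauchy_Schwarz_ip (R : realType) (H : normedModType R) (ip : H -> H -> R)
  (hip : inner_product ip) (h k : H) : `|ip h k| <= `|h| * `|k|.
Proof.
have [->|k0] := eqVneq k 0.
  by rewrite (ip_sym hip) (ip0l hip) normr0 normr0 mulr0.
have nk : 0 < `|k| by rewrite normr_gt0.
(* The vector below is [`|k| ^+ 2] times the component of [h] orthogonal to
   [k]; this form of it avoids dividing by [`|k| ^+ 2]. *)
have := sqr_ge0 `| `|k| ^+ 2 *: h - ip h k *: k |.
set u := _ - _; rewrite -(ip_norm hip u) {1}/u (ipBl hip) !(ipZl hip).
rewrite ((ip_sym hip) h) ((ip_sym hip) k u) /u !(ipBl hip) !(ipZl hip) !(ip_norm hip).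
rewrite (ip_sym hip k h) => e.
rewrite -ler_sqr ?nnegrE ?mulr_ge0 // real_normK ?num_real //.
have e2 : 0 <= `|k| ^+ 2 * ((`|h| * `|k|) ^+ 2 - ip h k ^+ 2).
  by apply: le_trans e _; rewrite le_eqVlt; apply/orP; left; apply/eqP; ring.
by move: e2; rewrite pmulr_rge0 ?exprn_gt0 // subr_ge0.
Qed.

Lemma ipl_continuous (R : realType) (H : normedModType R) (ip : H -> H -> R)
  (hip : inner_product ip) (k : H) : continuous (fun h => ip h k).
Proof.
move=> h; apply/cvgrPdist_le => e e0.
have k1 : 0 < `|k| + 1 by rewrite ltr_wpDl.
near=> h'.
rewrite -(ipBl hip); apply: le_trans (Cauchy_Schwarz_ip hip _ _) _.
have hh : `|h - h'| <= e / (`|k| + 1).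
  near: h'.
  by apply: (@cvgr_dist_le _ _ _ _ _ id h cvg_id); rewrite divr_gt0.
apply: (@le_trans _ _ (e / (`|k| + 1) * (`|k| + 1))).
  by apply: ler_pM => //; rewrite lerDl.
by rewrite divfK ?gt_eqF.
Unshelve. all: by end_near. Qed.

Lemma is_derive_ip (R : realType) (H : normedModType R) (ip : H -> H -> R)
  (hip : inner_product ip) (z : R -> H) (t : R) (dz k : H) :
  is_derive t 1 z dz -> is_derive t 1 (fun s => ip (z s) k) (ip dz k).
Proof.
move=> [dv dE].
have cvz : (fun s : R => s^-1 *: (z (s *: 1 + t) - z t)) @ 0^' --> dz.
  by rewrite -dE; exact: dv.
have : (fun s : R => s^-1 *: ((ip (z (s *: 1 + t)) k : R^o) - ip (z t) k)) @ 0^'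
    --> (ip dz k : R^o).
  have -> : (fun s : R => s^-1 *: ((ip (z (s *: 1 + t)) k : R^o) - ip (z t) k))
     = (fun h => ip h k) \o (fun s : R => s^-1 *: (z (s *: 1 + t) - z t)).
    by apply/funext => s /=; rewrite (ipZl hip) (ipBl hip).
  apply: cvg_comp; first exact: cvz.
  exact: ipl_continuous.
move=> cv; split; first by apply/cvg_ex; exists (ip dz k).
exact: (cvg_lim _ cv).
Qed.

(** Pairing with the increment [z t - z s] itself reduces this to the scalar
    mean value theorem, which has no equality form for vector-valued curves. *)
Lemma mean_value_inequality_ip (R : realType) (H : normedModType R)
  (ip : H -> H -> R) (hip : inner_product ip) (z dz : R -> H) (s t C : R) :
  s <= t -> {within `[s, t], continuous z} ->
  (forall r, s < r < t -> is_derive r 1 z (dz r) /\ `|dz r| <= C) ->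
  `|z t - z s| <= C * (t - s).
Proof.
rewrite le_eqVlt => /predU1P[->|st] zc zd.
  by rewrite !subrr normr0 mulr0.
set k := z t - z s.
have [c] := @MVT R (fun r => ip (z r) k) (fun r => ip (dz r) k) s t st
  (fun r hr => is_derive_ip hip _ (zd r hr).1)
  (fun y => continuous_comp (zc y) (@ipl_continuous _ _ _ hip k (z y))).
rewrite in_itv /= => cst; rewrite -(ipBl hip) -/k (ip_norm hip) => e.
have [k0|k0] := eqVneq k 0.
  rewrite k0 normr0 mulr_ge0 ?subr_ge0 ?(ltW st) //.
  exact: le_trans (zd c cst).2.
have nk : 0 < `|k| by rewrite normr_gt0.
rewrite -(ler_pM2l nk) -expr2 e mulrCA mulrA mulrC [leLHS]mulrC.
rewrite ler_wpM2r ?subr_ge0 ?(ltW st) //.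
apply: le_trans (ler_norm _) _; apply: le_trans (Cauchy_Schwarz_ip hip _ _) _.
by rewrite ler_wpM2r ?(zd c cst).2.
Qed.

(** * Spans and orthogonal projections *)

Lemma linspan_comb (R : realType) (H : lmodType R) (X : set H) (c : R) (h k : H) :
  linspan X h -> linspan X k -> linspan X (c *: h + k).
Proof.
move=> [p [a [u [uX ->]]]] [q [b [w [wX ->]]]].
exists (p + q)%N, (fun i : 'I_(p + q) => match fintype.split i with inl j => c * a j | inr j => b j end),
  (fun i : 'I_(p + q) => match fintype.split i with inl j => u j | inr j => w j end); split.
  by move=> i; case: fintype.splitP => j _.
rewrite big_split_ord /= scaler_sumr; congr (_ + _); apply: eq_bigr => i _.
  by rewrite (unsplitK (inl i)) scalerA.
by rewrite (unsplitK (inr i)).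
Qed.

Lemma linspan0 (R : realType) (H : lmodType R) (X : set H) : linspan X 0.
Proof.
exists 0%N, (fun=> 0), (fun=> 0); split; first by case.
by rewrite big_ord0.
Qed.

Lemma linspanZ (R : realType) (H : lmodType R) (X : set H) (c : R) (h : H) :
  linspan X h -> linspan X (c *: h).
Proof.
by move=> hX; rewrite -[c *: h]addr0; apply: linspan_comb => //; exact: linspan0.
Qed.

Lemma linspanB (R : realType) (H : lmodType R) (X : set H) (h k : H) :
  linspan X h -> linspan X k -> linspan X (h - k).
Proof.
by move=> hX kX; rewrite addrC -scaleN1r; apply: linspan_comb.
Qed.

Lemma sub_linspan (R : realType) (H : lmodType R) (X Y : set H) :
  X `<=` Y -> linspan X `<=` linspan Y.
Proof.
move=> XY h [p [c [u [uX ->]]]]; exists p, c, u; split => // i; exact: XY.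
Qed.

Lemma orth_proj_ip (R : realType) (H : normedModType R) (ip : H -> H -> R)
  (hip : inner_product ip) (V : set H) (P : H -> H) (hP : is_orth_proj ip V P)
  (h k : H) : V k -> ip (P h) k = ip h k.
Proof.
move=> Vk; have := (hP h).2 k Vk; rewrite (ipBl hip) => /eqP.
by rewrite subr_eq0 => /eqP.
Qed.

Lemma orth_proj_id (R : realType) (H : normedModType R) (ip : H -> H -> R)
  (hip : inner_product ip) (X : set H) (P : H -> H)
  (hP : is_orth_proj ip (linspan X) P) (h : H) : linspan X h -> P h = h.
Proof.
move=> Xh; apply/esym/eqP; rewrite -subr_eq0; apply/eqP.
apply: (inner_product_eq0 hip); apply: (hP h).2.
exact: linspanB Xh (hP h).1.
Qed.

(** * Regressor and gradient law *)

Lemma regressor_quadratic (R : realType) (n : nat) (H : normedModType R)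
  (ip : H -> H -> R) (hip : inner_product ip) (X : set H) (P : H -> H)
  (hP : is_orth_proj ip (linspan X) P) (A : H -> 'cV[R]_n -> R)
  (Aadj : 'cV[R]_n -> R -> H) (z : 'cV[R]_n)
  (hAadj : is_adjoint ip (fun h => A h z) (Aadj z)) (h : H) :
  linspan X h -> ip (regressor A Aadj P z h) h = A h z ^+ 2.
Proof.
move=> Xh; rewrite /regressor (orth_proj_ip hip hP) // hAadj.
by rewrite (orth_proj_id hip hP).
Qed.

(** The velocity [d] of the law lies in the subspace, where the projection
    disappears from inner products and the law reads
    [ip d k = a * A (v - h) z * A k z]; the choice [k = d] gives the bound. *)
Lemma gradient_law_speed (R : realType) (n : nat) (Omega : set 'cV[R]_n)
  (H : normedModType R)
  (ip : H -> H -> R) (hip : inner_product ip) (X : set H) (P : H -> H)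
  (hP : is_orth_proj ip (linspan X) P) (A : H -> 'cV[R]_n -> R)
  (hAb : bounded_linear_C Omega A) (M : R) (M0 : 0 <= M)
  (hM : forall h z, Omega z -> `|A h z| <= M * `|h|)
  (Aadj : 'cV[R]_n -> R -> H) (z : 'cV[R]_n) (Oz : Omega z)
  (hAadj : is_adjoint ip (fun h => A h z) (Aadj z)) (a : R) (ha : 0 < a) (v h : H) :
  linspan X h ->
  `|- (a *: regressor A Aadj P z h) + a *: P (Aadj z (A v z))|
    <= a * M * `|A (v - h) z|.
Proof.
move=> Xh; set d := - _ + _.
have Xd : linspan X d.
  rewrite /d addrC; apply: linspanB; apply: linspanZ; exact: (hP _).1.
have dE : `|d| ^+ 2 = a * A (v - h) z * A d z.
  rewrite -(ip_norm hip) {1}/d (ipDl hip) (ipNl hip) !(ipZl hip) /regressor.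
  rewrite !(orth_proj_ip hip hP) // !hAadj (orth_proj_id hip hP) //.
  have -> : A (v - h) z = A v z - A h z.
    by rewrite addrC -scaleN1r (blC_linear hAb) // mulN1r addrC.
  by ring.
have [d0|d0] := eqVneq d 0.
  by rewrite d0 normr0 !mulr_ge0 // ltW.
have nd : 0 < `|d| by rewrite normr_gt0.
rewrite -(ler_pM2r nd) -expr2 dE; apply: le_trans (ler_norm _) _.
rewrite !normrM (gtr0_norm ha) -!mulrA ler_pM2l //.
by rewrite [leRHS]mulrCA ler_wpM2l // hM.
Qed.

Lemma gradient_law_drift (R : realType) (n : nat) (Omega : set 'cV[R]_n)
  (H : normedModType R) (ip : H -> H -> R) (hip : inner_product ip) (X : set H)
  (P : H -> H) (hP : is_orth_proj ip (linspan X) P) (A : H -> 'cV[R]_n -> R)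
  (hAb : bounded_linear_C Omega A) (M : R) (M0 : 0 <= M)
  (hM : forall h z, Omega z -> `|A h z| <= M * `|h|)
  (Aadj : 'cV[R]_n -> R -> H)
  (hAadj : forall z, Omega z -> is_adjoint ip (fun h => A h z) (Aadj z))
  (x : R -> 'cV[R]_n) (hx : forall t, 0 <= t -> Omega (x t))
  (a : R) (ha : 0 < a) (v : H) (vh : R -> H)
  (hX : forall t, 0 <= t -> linspan X (vh t))
  (hvh : is_ode_solution (fun t w => - (a *: regressor A Aadj P (x t) w)
                   + a *: P (Aadj (x t) (A v (x t)))) vh)
  (s t L : R) :
  0 <= s <= t -> (forall u, s <= u <= t -> `|A (v - vh u) (x u)| <= L) ->
  `|vh t - vh s| <= a * M * L * (t - s).
Proof.
move=> /andP[s0 st] hL.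
apply: (mean_value_inequality_ip hip (dz := fun u =>
  - (a *: regressor A Aadj P (x u) (vh u)) + a *: P (Aadj (x u) (A v (x u))))) => //.
  apply: continuous_subspaceW hvh.1; apply: subset_itv; rewrite bnd_simp //.
move=> u /andP[su ut]; have u0 : 0 < u by exact: le_lt_trans su.
split; first exact: hvh.2.
apply: le_trans (gradient_law_speed hip hP hAb M0 hM (hx u (ltW u0))
  (hAadj _ (hx u (ltW u0))) ha v (hX u (ltW u0))) _.
by rewrite ler_wpM2l ?mulr_ge0 ?(ltW ha) // hL // !ltW.
Qed.

(** * Energy on windows of time *)

Lemma Rintegral_itvD (R : realType) (q : R -> R) (s r t : R) :
  s <= r <= t ->
  (@lebesgue_measure R).-integrable `[s, t] (EFin \o q) ->
  \int[@lebesgue_measure R]_(u in `[s, t]) q u =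
  \int[@lebesgue_measure R]_(u in `[s, r]) q u +
  \int[@lebesgue_measure R]_(u in `[r, t]) q u.
Proof.
move=> /andP[sr rt] iq; apply/eqP; rewrite addrC -subr_eq; apply/eqP.
rewrite Rintegral_itvB //; try by rewrite bnd_simp.
rewrite Rintegral_itv_obnd_cbnd //.
apply: integrableS iq => //; apply: subset_itv; rewrite bnd_simp //.
Qed.

(** The horizon [T] contains [k] consecutive windows of length [d], where [k] is
    the integer part of [T / d]; each contributes at least [c] to a total of at
    most [C], so [k <= C / c]. *)
Lemma windows_in_horizon (R : realType) (q : R -> R) (c C d T : R) :
  0 < c -> 0 < d -> 0 <= T -> (forall t, 0 <= t -> 0 <= q t) ->
  (@lebesgue_measure R).-integrable `[0, T] (EFin \o q) ->
  (forall t, 0 <= t -> c <= \int[@lebesgue_measure R]_(u in `[t, t + d]) q u) ->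
  \int[@lebesgue_measure R]_(u in `[0, T]) q u <= C ->
  T <= d * (C / c + 1).
Proof.
move=> c0 d0 T0 q0 iq qc qC.
have J (k : nat) : k%:R * d <= T ->
    k%:R * c <= \int[@lebesgue_measure R]_(u in `[0, k%:R * d]) q u.
  elim: k => [|k IH] kT.
    by rewrite mul0r; apply: Rintegral_ge0 => // u; rewrite /= in_itv /= => /andP[/q0].
  have kd : k%:R * d <= k.+1%:R * d by rewrite ler_pM2r // ler_nat.
  have kd0 : 0 <= k%:R * d by rewrite mulr_ge0 // ltW.
  rewrite (Rintegral_itvD (r := k%:R * d)) ?kd0 //; last first.
    by apply: integrableS iq => //; apply: subset_itv; rewrite bnd_simp.
  have -> : k.+1%:R * c = k%:R * c + c by rewrite -addn1 natrD mulrDl mul1r.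
  apply: lerD; first exact: IH (le_trans kd kT).
  have -> : k.+1%:R * d = k%:R * d + d by rewrite -addn1 natrD mulrDl mul1r.
  exact: qc.
have Td0 : 0 <= T / d by rewrite divr_ge0 // ltW.
have /andP[lk kl] := truncn_itv Td0; set k := Num.trunc _ in lk kl.
have kT : k%:R * d <= T by rewrite -ler_pdivlMr.
have kd0 : 0 <= k%:R * d by rewrite mulr_ge0 // ltW.
have kc : k%:R * c <= C.
  apply: le_trans qC; rewrite (Rintegral_itvD (r := k%:R * d)) ?kd0 //.
  rewrite -[leLHS]addr0; apply: lerD; first exact: J.
  apply: Rintegral_ge0 => // u; rewrite /= in_itv /= => /andP[ku _].
  by apply: q0; exact: le_trans ku.
rewrite mulrC -ler_pdivrMr //; apply: le_trans (ltW kl) _.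
by rewrite -natr1 lerD2r ler_pdivlMr.
Qed.

Lemma Rintegral_sqr_le (R : realType) (b : R -> R) (s d B : R) :
  0 < d -> (forall u, s <= u <= s + d -> `|b u| <= B) ->
  (@lebesgue_measure R).-integrable `[s, s + d] (EFin \o (fun u => b u ^+ 2)) ->
  \int[@lebesgue_measure R]_(u in `[s, s + d]) (b u ^+ 2) <= B ^+ 2 * d.
Proof.
move=> d0 bB ib.
have sd : s <= s + d by rewrite lerDl ltW.
have mE : (@lebesgue_measure R) `[s, s + d] = d%:E.
  rewrite lebesgue_measure_itv /= lte_fin ltrDl d0 -EFinD.
  by congr (_%:E); ring.
have -> : B ^+ 2 * d = \int[@lebesgue_measure R]_(u in `[s, s + d]) (B ^+ 2).
  rewrite Rintegral_cst //; congr (_ * _).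
  by rewrite -[LHS]/(fine d%:E) -mE.
apply: le_Rintegral => //.
- by apply: measurable_bounded_integrable => //;
    [rewrite [ltLHS]mE ltry | exact: bounded_cst].
- move=> u; rewrite /= in_itv /= => su.
  have B0 : 0 <= B by exact: le_trans (bB u su).
  by rewrite -[b u ^+ 2]real_normK ?num_real // ler_sqr ?nnegrE ?bB.
Qed.

(** [I] is squeezed between [g1 * r ^+ 2] and the geometric mean of its two upper
    bounds; this plays the part of the Cauchy-Schwarz inequality for the
    integral [I]. *)
Lemma persistent_excitation_bound (R : realType) (g1 g2 d B I r : R) :
  0 < g1 -> 0 < g2 -> 0 < d -> 0 <= B -> 0 <= r ->
  g1 * r ^+ 2 <= I -> I <= g2 * r ^+ 2 -> I <= B ^+ 2 * d ->
  r <= Num.sqrt (g2 * d) / g1 * B.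
Proof.
move=> g1p g2p dp B0 r0 lI I1 I2.
have I0 : 0 <= I by apply: le_trans lI; rewrite mulr_ge0 ?sqr_ge0 ?ltW.
rewrite mulrAC ler_pdivlMr //.
have [->|rn] := eqVneq r 0; first by rewrite mul0r mulr_ge0 ?sqrtr_ge0.
have rp : 0 < r ^+ 2 by rewrite exprn_gt0 // lt_neqAle eq_sym rn.
rewrite -ler_sqr ?nnegrE ?mulr_ge0 ?sqrtr_ge0 ?(ltW g1p) //.
rewrite [leRHS]exprMn sqr_sqrtr ?mulr_ge0 ?(ltW g2p) ?(ltW dp) //.
rewrite -(ler_pM2r rp).
have -> : (r * g1) ^+ 2 * r ^+ 2 = (g1 * r ^+ 2) * (g1 * r ^+ 2) by ring.
have -> : g2 * d * B ^+ 2 * r ^+ 2 = (g2 * r ^+ 2) * (B ^+ 2 * d) by ring.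
apply: (@le_trans _ _ (I * I)).
  by apply: ler_pM => //; rewrite mulr_ge0 ?(ltW rp) ?(ltW g1p).
by apply: ler_pM.
Qed.

(** The bound [M] is needed because [sup] of an unbounded set is 0. *)
Lemma sup_on_ge (R : realType) (s t M : R) (u : R -> R) :
  (forall tau, s <= tau <= t -> u tau <= M) ->
  forall tau, s <= tau <= t -> u tau <= sup_on s t u.
Proof.
move=> uM tau st; apply: ub_le_sup.
  by exists M => _ [r /= hr <-]; apply: uM; move: hr; rewrite in_itv.
by exists tau => //=; rewrite in_itv.
Qed.

Lemma norm_bounded_itv (R : realType) (V : normedModType R) (z : R -> V) (s t : R) :
  {within `[s, t], continuous z} ->
  exists C : R, forall tau, s <= tau <= t -> `|z tau| <= C.
Proof.
move=> zc.
have [C [_ hC]] := compact_bounded (continuous_compact zc (@segment_compact R s t)).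
exists (C + 1) => tau st; apply: (hC (C + 1)); first by rewrite ltrDl.
by exists tau => //=; rewrite in_itv.
Qed.

Lemma excitation_quadratic (R : realType) (n : nat) (Omega : set 'cV[R]_n)
  (H : normedModType R) (ip : H -> H -> R) (hip : inner_product ip) (X : set H)
  (P : H -> H) (hP : is_orth_proj ip (linspan X) P) (A : H -> 'cV[R]_n -> R)
  (Aadj : 'cV[R]_n -> R -> H)
  (hAadj : forall z, Omega z -> is_adjoint ip (fun h => A h z) (Aadj z))
  (x : R -> 'cV[R]_n) (s t : R) (hx : forall u, s <= u <= t -> Omega (x u))
  (h I : H) :
  linspan X h -> is_integral ip s t (fun u => regressor A Aadj P (x u) h) I ->
  (@lebesgue_measure R).-integrable `[s, t] (EFin \o (fun u => A h (x u) ^+ 2))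
  /\ ip I h = \int[@lebesgue_measure R]_(u in `[s, t]) (A h (x u) ^+ 2).
Proof.
move=> Xh /(_ h) [iI ->].
have E : {in `[s, t]%classic, (fun u => ip (regressor A Aadj P (x u) h) h) =1
                    (fun u => A h (x u) ^+ 2)}.
  move=> u /set_mem; rewrite /= in_itv /= => su.
  exact: (regressor_quadratic hip hP (hAadj _ (hx u su))).
split; last exact: eq_Rintegral.
by apply: eq_integrable iI => // u /E /= ->.
Qed.

(** The least [N0] with [V N0] nonzero serves every larger [N] at once: a nonzero
    [h0] of [V N0] lies in each [V N], and its energy on a window of length
    [Delta N] is at most [g2 * `|h0| ^+ 2] but grows by at least
    [g1 N0 * `|h0| ^+ 2] over every stretch of length [Delta N0]. *)
Lemma excitation_horizons_bounded (R : realType) (H : normedModType R)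
  (V : nat -> set H) (hV : forall N N', (N <= N')%N -> V N `<=` V N')
  (q : H -> R -> R) (hq : forall h t, 0 <= t -> 0 <= q h t)
  (Delta g1 : nat -> R) (g2 : R)
  (hDelta : forall N, (0 < N)%N -> 0 < Delta N)
  (hg1 : forall N, (0 < N)%N -> 0 < g1 N)
  (hqi : forall N t h, (0 < N)%N -> 0 <= t -> V N h ->
    (@lebesgue_measure R).-integrable `[t, t + Delta N] (EFin \o q h))
  (hPE : forall N t h, (0 < N)%N -> 0 <= t -> V N h ->
    g1 N * `|h| ^+ 2 <= \int[@lebesgue_measure R]_(u in `[t, t + Delta N]) q h u
      <= g2 * `|h| ^+ 2) :
  exists D : R, forall N h, (0 < N)%N -> V N h -> h != 0 -> Delta N <= D.
Proof.
have [ex|nex] := pselect (exists N, `[< (0 < N)%N /\ exists2 h, V N h & h != 0 >]);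
  last first.
  exists 0 => N h N0 VNh h0; exfalso; apply: nex; exists N; apply/asboolP.
  by split => //; exists h.
have [N0 /asboolP[N0p [h0 Vh0 h0n]] minN0] := ex_minnP ex.
exists (Delta N0 * (g2 * `|h0| ^+ 2 / (g1 N0 * `|h0| ^+ 2) + 1)) => N h Np VNh hn.
have NN : (N0 <= N)%N by apply: minN0; apply/asboolP; split => //; exists h.
have VN := hV _ _ NN _ Vh0.
have /andP[_ up] := hPE N 0 h0 Np (lexx 0) VN.
have iq := hqi N 0 h0 Np (lexx 0) VN.
rewrite !add0r in up iq.
apply: (windows_in_horizon (q := q h0)) up => //.
- by rewrite mulr_gt0 ?hg1 // exprn_gt0 // normr_gt0.
- exact: hDelta.
- exact/ltW/hDelta.
- by move=> t; exact: hq.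
- by move=> t t0; have /andP[] := hPE N0 t h0 N0p t0 Vh0.
Qed.

(** * The error bound *)

Theorem theorem2 (R : realType) (n m : nat)
  (* domain, dynamics, cost *)
  (Omega : set 'cV[R]_n) (hOmega : compact Omega) (hOmega0 : Omega 0)
  (f : 'cV[R]_n -> 'cV[R]_n) (g : 'cV[R]_n -> 'M[R]_(n, m))
  (mu : 'cV[R]_n -> 'cV[R]_m) (hmu : continuous mu)
  (hstab : stabilizing Omega f g mu)
  (Q : 'cV[R]_n -> R) (hQ : forall x, 0 <= Q x)
  (W : 'M[R]_m) (hW : posdefmx W)
  (* trajectory *)
  (x0 : 'cV[R]_n) (x : R -> 'cV[R]_n)
  (hx : is_ode_solution (fun=> closed_loop f g mu) x) (hx0 : x 0 = x0)
  (hxOmega : forall t, 0 <= t -> Omega (x t))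
  (* kernel and native space *)
  (K : 'cV[R]_n -> 'cV[R]_n -> R) (hK : mercer_kernel Omega K)
  (m' : nat) (hm' : (1 <= m')%N) (hKC : Ck_kernel (2 * m') Omega K)
  (H : completeNormedModType R) (ip : H -> H -> R) (kx : 'cV[R]_n -> H)
  (ev : H -> 'cV[R]_n -> R) (hH : is_rkhs Omega K ip kx ev)
  (* the differential operator and its adjoint evaluations *)
  (hfm : forall i, multiplier Omega ev (fun z => f z i ord0))
  (hgm : forall i j, multiplier Omega ev (fun z => g z i j))
  (hmum : forall j, multiplier Omega ev (fun z => mu z j ord0))
  (A : H -> 'cV[R]_n -> R)
  (hA : is_directional_operator Omega ev (closed_loop f g mu) A)
  (hAb : bounded_linear_C Omega A)
  (Aadj : 'cV[R]_n -> R -> H)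
  (hAadj : forall z, Omega z -> is_adjoint ip (fun h => A h z) (Aadj z))
  (* value function *)
  (v : H) (hv : forall z, Omega z -> A v z + running_cost Q W mu z = 0)
  (hv0 : ev v 0 = 0)
  (* centers and projections *)
  (xi : nat -> 'cV[R]_n) (hxi : forall i, Omega (xi i)) (hxi_inj : injective xi)
  (P : nat -> H -> H)
  (hP : forall N, (0 < N)%N -> is_orth_proj ip (center_space kx xi N) (P N))
  (* boundedness of the kernel on the diagonal *)
  (Kbar : R) (hKbar : forall z, Omega z -> K z z <= Kbar ^+ 2)
  (* persistency of excitation *)
  (Delta gamma1 : nat -> R) (gamma2 : R)
  (hDelta : forall N, (0 < N)%N -> 0 < Delta N)
  (hgamma1 : forall N, (0 < N)%N -> 0 < gamma1 N) (hgamma2 : 0 < gamma2)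
  (S : nat -> R -> H -> H)
  (hS : forall N t h, (0 < N)%N -> 0 <= t -> center_space kx xi N h ->
     is_integral ip t (t + Delta N)
       (fun tau => regressor A Aadj (P N) (x tau) h) (S N t h))
  (hPE : forall N t h, (0 < N)%N -> 0 <= t -> center_space kx xi N h ->
     gamma1 N * ip h h <= ip (S N t h) h <= gamma2 * ip h h)
  (* gradient learning law *)
  (a : R) (ha : 0 < a)
  (vhat : nat -> R -> H)
  (hvhatH : forall N t, (0 < N)%N -> 0 <= t -> center_space kx xi N (vhat N t))
  (hvhat : forall N, (0 < N)%N ->
     is_ode_solution
       (fun t w => - (a *: regressor A Aadj (P N) (x t) w)
                   + a *: P N (Aadj (x t) (A v (x t)))) (vhat N))
  (* regularity of the value function errors *)
  (hreg : forall N t, (0 < N)%N -> 0 <= t ->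
     exists h : H, forall z, Omega z -> ev h z = A (v - vhat N t) z) :
  let vbar N t := P N v - vhat N t in
  let Ymax N t := sup_on t (t + Delta N)
                    (fun tau => `|A (P N (vbar N tau)) (x tau)|) in
  let epsmax N t := sup_on t (t + Delta N)
                      (fun tau => `|A (v - P N v) (x tau)|) in
  exists2 delta : R, 0 < delta &
    forall N t, (0 < N)%N -> 0 <= t ->
      `|vbar N t| <= Num.sqrt (gamma2 * Delta N) / gamma1 N *
         (Ymax N t + delta * gamma2 * a * (Ymax N t + epsmax N t)).
Proof.
move=> vbar Ymax epsmax.
have hip := rkhs_ip hH.
have [M M0 hM] : exists2 M : R, 0 <= M &
    forall h z, Omega z -> `|A h z| <= M * `|h|.
  have [M hM] := blC_bounded hAb; exists `|M| => // h z Oz.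
  apply: le_trans (hM h z Oz) _; by rewrite ler_wpM2r // ler_norm.
have AD h k z : Omega z -> A (h + k) z = A h z + A k z.
  by move=> Oz; rewrite -[h in LHS]scale1r (blC_linear hAb) // mul1r.
have winOmega t d u : 0 <= t -> t <= u <= t + d -> Omega (x u).
  by move=> t0 /andP[tu _]; apply/hxOmega/(le_trans t0).
have quad N t h (N0 : (0 < N)%N) (t0 : 0 <= t) (Vh : center_space kx xi N h) :=
  excitation_quadratic hip (hP N N0) hAadj
    (fun u => winOmega t (Delta N) u t0) Vh (hS N t h N0 t0 Vh).
have PE N t h : (0 < N)%N -> 0 <= t -> center_space kx xi N h ->
    gamma1 N * `|h| ^+ 2 <=
      \int[@lebesgue_measure R]_(u in `[t, t + Delta N]) (A h (x u) ^+ 2)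
      <= gamma2 * `|h| ^+ 2.
  by move=> N0 t0 Vh; rewrite -(quad N t h N0 t0 Vh).2 -(ip_norm hip); apply: hPE.
have [D hD] : exists D : R, forall N h, (0 < N)%N -> center_space kx xi N h ->
    h != 0 -> Delta N <= D.
  apply: (@excitation_horizons_bounded R H (center_space kx xi) _
    (fun h u => A h (x u) ^+ 2) _ Delta gamma1 gamma2 hDelta hgamma1 _ PE).
  - move=> N N' NN'; apply: sub_linspan => _ [i /= iN <-].
    by exists i => //=; exact: leq_trans NN'.
  - by move=> h t _; exact: sqr_ge0.
  - by move=> N t h N0 t0 Vh; exact: (quad N t h N0 t0 Vh).1.
(* [M ^+ 2 * `|D| / gamma2] is what the estimate uses; adding 1 makes it
   positive also when [A] vanishes. *)
exists (M ^+ 2 * `|D| / gamma2 + 1).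
  by rewrite ltr_wpDl // divr_ge0 ?mulr_ge0 ?sqr_ge0 ?(ltW hgamma2).
move=> N t N0 t0.
have VE u : 0 <= u -> center_space kx xi N (vbar N u).
  by move=> u0; apply: linspanB; [exact: (hP N N0 v).1 | exact: hvhatH].
have d0 := hDelta N N0.
have tt : t <= t <= t + Delta N by rewrite lexx lerDl ltW.
have upos u : t <= u <= t + Delta N -> 0 <= u.
  by move=> /andP[tu _]; exact: le_trans tu.
(* The two suprema are suprema of bounded sets, hence upper bounds. *)
have [C hC] : exists C : R, forall u, t <= u <= t + Delta N -> `|vhat N u| <= C.
  apply: norm_bounded_itv; apply: continuous_subspaceW (hvhat N N0).1.
  by apply: subset_itv; rewrite bnd_simp.
have Yge u : t <= u <= t + Delta N -> `|A (vbar N u) (x u)| <= Ymax N t.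
  move=> tu; rewrite -{1}(orth_proj_id hip (hP N N0) (VE u (upos u tu))).
  apply: (sup_on_ge (M := M * (`|P N v| + C))) tu => r tr.
  rewrite (orth_proj_id hip (hP N N0) (VE r (upos r tr))).
  apply: le_trans (hM _ _ (winOmega _ _ _ t0 tr)) _.
  rewrite ler_wpM2l //; apply: le_trans (ler_normB _ _) _.
  by rewrite lerD2l hC.
have Ege u : t <= u <= t + Delta N -> `|A (v - P N v) (x u)| <= epsmax N t.
  move=> tu; apply: (sup_on_ge (M := M * `|v - P N v|)) tu => r tr.
  exact: hM (winOmega _ _ _ t0 tr).
have Y0 : 0 <= Ymax N t by exact: le_trans (Yge t tt).
have E0 : 0 <= epsmax N t by exact: le_trans (Ege t tt).
set YE := Ymax N t + epsmax N t.
have YE0 : 0 <= YE by exact: addr_ge0.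
have drift u : t <= u <= t + Delta N ->
    `|vbar N t - vbar N u| <= a * M * YE * Delta N.
  move=> /andP[tu ut].
  have -> : vbar N t - vbar N u = vhat N u - vhat N t.
    by rewrite /vbar opprB addrC addrA subrK.
  apply: le_trans (gradient_law_drift (L := YE) hip (hP N N0) hAb M0 hM hAadj hxOmega ha
    (fun u => hvhatH N u N0) (hvhat N N0) _ _) _.
  - by rewrite t0.
  - move=> r /andP[tr ru]; have tr' : t <= r <= t + Delta N.
      by rewrite tr (le_trans ru).
    have -> : v - vhat N r = vbar N r + (v - P N v).
      by rewrite /vbar [RHS]addrC addrA subrK.
    rewrite AD; last exact: winOmega tr'.
    by apply: le_trans (ler_normD _ _) _; apply: lerD; [exact: Yge | exact: Ege].
  by rewrite ler_wpM2l ?mulr_ge0 ?(ltW ha) // lerBlDl.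
have [w0|w0] := eqVneq (vbar N t) 0.
  rewrite w0 normr0 mulr_ge0 //.
    by rewrite divr_ge0 ?sqrtr_ge0 // ltW ?hgamma1.
  rewrite addr_ge0 // !mulr_ge0 ?(ltW hgamma2) ?(ltW ha) //.
  by rewrite addr_ge0 // divr_ge0 ?mulr_ge0 ?(ltW hgamma2).
have DN : Delta N <= `|D|.
  exact: le_trans (hD N _ N0 (VE t t0) w0) (ler_norm _).
have /andP[lo up] := PE N t (vbar N t) N0 t0 (VE t t0).
have bB u : t <= u <= t + Delta N -> `|A (vbar N t) (x u)| <=
    Ymax N t + (M ^+ 2 * `|D| / gamma2 + 1) * gamma2 * a * YE.
  move=> tu; rewrite -[vbar N t](subrK (vbar N u)) addrC AD; last exact: winOmega tu.
  apply: le_trans (ler_normD _ _) _; apply: lerD; first exact: Yge.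
  apply: le_trans (hM _ _ (winOmega _ _ _ t0 tu)) _.
  apply: (@le_trans _ _ (M * (a * M * YE * `|D|))).
    rewrite ler_wpM2l //; apply: le_trans (drift u tu) _.
    by rewrite ler_wpM2l // !mulr_ge0 // ltW.
  have -> : (M ^+ 2 * `|D| / gamma2 + 1) * gamma2 * a * YE =
      M * (a * M * YE * `|D|) + gamma2 * a * YE.
    by field; rewrite gt_eqF.
  by rewrite lerDl !mulr_ge0 // ltW.
apply: persistent_excitation_bound lo up _ => //; first exact: hgamma1.
  exact: le_trans (bB t tt).
exact: Rintegral_sqr_le bB (quad N t _ N0 t0 (VE t t0)).1.
Qed.
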